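(* Let $\{X_t\}_{t=0}^{\infty}$ be an aperiodic irreducible (time-homogeneous) Markov chain with finite state space $S$ and stationary distribution $\pi$. Let $\Phi\colon S\to\mathbb{R}$, $\gamma\in(0,\tfrac12)$ and $\rho>0$ be such that for every $t\ge 0$, almost surely, $$(1-\gamma)\Phi(X_t)-\rho\;\le\;\mathbb{E}[\Phi(X_{t+1})\mid X_t]\;\le\;(1-\gamma)\Phi(X_t)+\rho .$$ Let $R$ be a real number with $$R\;\ge\;\max_{s\in S}\mathbb{E}\big[(\Phi(X_{t+1})-\Phi(X_t))^2\mid X_t=s\big],$$ put $\hat\Phi=\max_{s\in S}\Phi(s)$, assume $\hat\Phi>0$, and let the chain start from a state $s_0$ with $\Phi(s_0)=\hat\Phi$. Fix $\varepsilon>0$ and put $$T=\frac{\log\hat\Phi-\log\!\left(\dfrac{2\rho}{\gamma}+\sqrt{\dfrac{4(R+6\rho\hat\Phi)}{\gamma\varepsilon}}\right)}{-\log(1-\gamma)} .$$ Then for every integer $t\ge 0$ with $t\le T$, $$\|P(X_t\in\cdot)-\pi\|\ge 1-\varepsilon .$$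
   Context: For probability measures $\mu,\nu$ on a finite set $S$, $\|\mu-\nu\|$ denotes the total variation norm $\|\mu-\nu\|=\tfrac12\sum_{s\in S}|\mu(s)-\nu(s)|=\max_{A\subseteq S}(\mu(A)-\nu(A))$. The almost sure inequality on conditional expectations is a condition on the transition matrix of the chain: for every $s\in S$, $|\mathbb{E}[\Phi(X_{t+1})\mid X_t=s]-(1-\gamma)\Phi(s)|\le\rho$. Here $\log$ is the natural logarithm. *)

(* Defs.v *)
From HB Require Import structures.
From mathcomp Require Import all_boot all_order all_algebra.
From mathcomp Require Import all_classical all_reals all_analysis.

Set Implicit Arguments.
Unset Strict Implicit.
Unset Printing Implicit Defensive.

Import Order.TTheory GRing.Theory Num.Theory.
Import numFieldNormedType.Exports.

Local Open Scope classical_set_scope.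
Local Open Scope ring_scope.

Section FiniteStateSpace.
Context {K : realType} {S : finType}.
Implicit Types (mu nu : S -> K) (M : S -> S -> K) (f : S -> K).

(* Probability measures on S are represented by their mass functions. *)
Definition is_pmf mu : Prop :=
  (forall s, 0 <= mu s) /\ \sum_(s : S) mu s = 1.

Definition tv_norm mu nu : K := 2^-1 * \sum_(s : S) `|mu s - nu s|.

(* The first argument only witnesses that S is nonempty: the value is the
   maximum of f over all of S, whichever s0 is given. *)
Definition max_over (s0 : S) f : K := \big[Order.max/f s0]_(s : S) f s.

Definition is_stochastic M : Prop := forall s, is_pmf (M s).

Fixpoint nstep M (n : nat) (x y : S) : K :=
  if n is m.+1 then \sum_(z : S) M x z * nstep M m z y else (x == y)%:R.

Definition irreducible_chain M : Prop :=
  forall x y, exists n : nat, 0 < nstep M n x y.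

(* For every x, the greatest common divisor of {n >= 1 | M^n(x, x) > 0} is 1. *)
Definition aperiodic_chain M : Prop :=
  forall (x : S) (d : nat),
    (forall n : nat, (0 < n)%N -> 0 < nstep M n x x -> (d %| n)%N) -> d = 1%N.

Definition stationary M mu : Prop :=
  is_pmf mu /\ forall y, \sum_(x : S) mu x * M x y = mu y.

(* E[f(X_{t+1}) | X_t = s] for a chain with transition matrix M. *)
Definition step_expectation M f (s : S) : K := \sum_(y : S) M s y * f y.

End FiniteStateSpace.

Section Process.
Context {K : realType} {S : finType} {d : measure_display}
  {Omega : measurableType d}.
Variables (P : probability Omega K) (X : nat -> Omega -> S).

Definition cond_prob (A B : set Omega) : K := fine (P (A `&` B)) / fine (P B).

Definition history (x : nat -> S) (t : nat) : set Omega :=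
  [set w | forall i : nat, (i <= t)%N -> X i w = x i].

Definition law (t : nat) : S -> K := fun s => fine (P (X t @^-1` [set s])).

(* S carries the discrete sigma-algebra, so X_t is measurable exactly when
   the preimages of its points are. *)
Record markov_chain (M : S -> S -> K) : Prop := MarkovChain {
  markov_measurable : forall (t : nat) (s : S), measurable (X t @^-1` [set s]);
  markov_stochastic : is_stochastic M;
  markov_property : forall (t : nat) (x : nat -> S) (y : S),
    (0 < P (history x t))%E ->
    cond_prob (X t.+1 @^-1` [set y]) (history x t) = M (x t) y
}.

End Process.

(* Main.v *)
Require Import Defs.
From HB Require Import structures.
From mathcomp Require Import all_boot all_order all_algebra.
From mathcomp Require Import all_classical all_reals all_analysis.
From mathcomp Require Import ring lra.

Set Implicit Arguments.
Unset Strict Implicit.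
Unset Printing Implicit Defensive.

Import Order.TTheory GRing.Theory Num.Theory.
Import numFieldNormedType.Exports.

Local Open Scope classical_set_scope.
Local Open Scope ring_scope.

(** Two laws are nearly singular as soon as one real statistic separates them:
    if the means of [Phi] differ by at least [2 * h] and both variances are at
    most [v], Chebyshev's inequality gives total variation distance at least
    [1 - 2 * v / h ^+ 2] ([tv_norm_ge_of_means]). The drift condition controls
    both moments.

    One step multiplies the mean of [Phi] by [1 - gamma] up to an error [rho]
    ([mean_drift]). Summing the geometric series, the mean at time [t] is at
    least [(1 - gamma) ^+ t * hatPhi - rho / gamma], while a stationary mean is
    at most [rho / gamma] in absolute value. The bound [t <= T] says exactly
    that [(1 - gamma) ^+ t * hatPhi] is at least [2 * rho / gamma] plus the
    square root in [T] ([le_geometric_of_ln]), so the means differ by at least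
    this square root.

    One step multiplies the variance of [Phi] by [1 - 2 * gamma] up to an error
    [R + 6 * rho * hatPhi], provided that the current mean is not below
    [- hatPhi / 2] ([variance_contract]). The means at all times and the
    stationary mean satisfy this proviso because [2 * rho / gamma <= hatPhi].
    Hence the variance is at most [(R + 6 * rho * hatPhi) / (2 * gamma)] at all
    times, since it starts at 0, and also under the stationary law. With half
    the square root as [h], the Chebyshev loss [2 * v / h ^+ 2] is [epsilon].

    These estimates concern the iteration of the transition matrix on mass
    functions; [law_evolve] derives from the Markov property that the laws of
    the process follow it. *)

(** * Means and variances of mass functions *)

Section MeanVariance.
Context {K : realType} {S : finType}.
Implicit Types (mu nu f g : S -> K) (M : S -> S -> K) (a b c h m v : K).

Definition mean mu f : K := \sum_(s : S) mu s * f s.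

Definition variance mu f : K := mean mu (fun s => (f s - mean mu f) ^+ 2).

Lemma mean_affine mu f g a b c : is_pmf mu ->
  mean mu (fun s => a * f s + b * g s + c) = a * mean mu f + b * mean mu g + c.
Proof.
case=> _ mu1; rewrite /mean -[c in RHS]mulr1 -mu1 !mulr_sumr -!big_split /=.
by apply: eq_bigr => s _; ring.
Qed.

Lemma eq_mean mu f g : f =1 g -> mean mu f = mean mu g.
Proof. by move=> fg; apply: eq_bigr => s _; rewrite fg. Qed.

Lemma le_mean mu f g : is_pmf mu -> (forall s, f s <= g s) ->
  mean mu f <= mean mu g.
Proof. by case=> mu0 _ fg; apply: ler_sum => s _; apply: ler_wpM2l. Qed.

Lemma mean_le_cst mu f c : is_pmf mu -> (forall s, f s <= c) -> mean mu f <= c.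
Proof.
move=> mup fc; apply: le_trans (le_mean mup fc) _.
by rewrite /mean -mulr_suml (proj2 mup) mul1r.
Qed.

Lemma mean_ge0 mu f : is_pmf mu -> (forall s, 0 <= f s) -> 0 <= mean mu f.
Proof. by case=> mu0 _ f0; apply: sumr_ge0 => s _; apply: mulr_ge0. Qed.

(** Koenig-Huygens, about an arbitrary centre [c]. *)
Lemma mean_sqr_shift mu f c : is_pmf mu ->
  mean mu (fun s => (f s - c) ^+ 2)
  = mean mu (fun s => f s ^+ 2) - 2 * c * mean mu f + c ^+ 2.
Proof.
move=> mup.
rewrite (@eq_mean _ _ (fun s => 1 * f s ^+ 2 + (- (2 * c)) * f s + c ^+ 2)).
  by rewrite (@mean_affine mu (fun s => f s ^+ 2) f) //; ring.
by move=> s; ring.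
Qed.

Lemma varianceE mu f : is_pmf mu ->
  variance mu f = mean mu (fun s => f s ^+ 2) - mean mu f ^+ 2.
Proof. by move=> mup; rewrite /variance mean_sqr_shift //; ring. Qed.

(** The overlap [\sum_s min (mu s) (nu s)] is 1 minus the total variation
    distance. A point [s] cannot be within [h] of both means, so
    [min (mu s) (nu s)] is charged either to the Chebyshev weight of [mu] or to
    that of [nu]; summing these charges is Chebyshev's inequality for both. *)
Lemma tv_norm_ge_of_means mu nu f h v : is_pmf mu -> is_pmf nu ->
  0 < h -> 2 * h <= mean mu f - mean nu f ->
  variance mu f <= v -> variance nu f <= v ->
  1 - 2 * v / h ^+ 2 <= tv_norm mu nu.
Proof.
move=> mup nup h0 gap vmu vnu.
have [mu0 mu1] := mup; have [nu0 nu1] := nup.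
have h20 : 0 < (h ^+ 2)^-1 by rewrite invr_gt0 exprn_gt0.
pose q c s := (f s - c) ^+ 2 / h ^+ 2.
have q0 c s : 0 <= q c s by rewrite mulr_ge0 ?sqr_ge0 // ltW.
have q1 c s : h ^+ 2 <= (f s - c) ^+ 2 -> 1 <= q c s.
  by move=> hle; rewrite ler_pdivlMr ?exprn_gt0 // mul1r.
have pt s : mu s + nu s - 2 * (mu s * q (mean mu f) s + nu s * q (mean nu f) s)
    <= `|mu s - nu s|.
  have mus := mulr_ge0 (mu0 s) (q0 (mean mu f) s).
  have nus := mulr_ge0 (nu0 s) (q0 (mean nu f) s).
  have [far|close] := leP (mean nu f + h) (f s).
    have /(ler_wpM2l (nu0 s)) : 1 <= q (mean nu f) s.
      by apply: q1; rewrite ler_pXn2r ?nnegrE //; lra.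
    by have := ler_norm (mu s - nu s); lra.
  have /(ler_wpM2l (mu0 s)) : 1 <= q (mean mu f) s.
    by apply: q1; rewrite -[leRHS]sqrrN ler_pXn2r ?nnegrE //; lra.
  by have := ler_norm (nu s - mu s); rewrite distrC; lra.
have qE rho c : \sum_s rho s * q c s
    = mean rho (fun s => (f s - c) ^+ 2) / h ^+ 2.
  by rewrite /mean mulr_suml; apply: eq_bigr => s _; rewrite /q mulrA.
have : \sum_s (mu s + nu s
    - 2 * (mu s * q (mean mu f) s + nu s * q (mean nu f) s))
    <= \sum_s `|mu s - nu s| by apply: ler_sum => s _; exact: pt.
rewrite sumrB -mulr_sumr !big_split /= mu1 nu1 !qE -!/(variance _ _) /tv_norm.
have := ler_wpM2r (ltW h20) vmu; have := ler_wpM2r (ltW h20) vnu.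
by lra.
Qed.

(** Row vector times transition matrix. *)
Definition evolve M mu : S -> K := fun y => \sum_(x : S) mu x * M x y.

Lemma mean_evolve M mu f :
  mean (evolve M mu) f = mean mu (step_expectation M f).
Proof.
rewrite /mean /evolve /step_expectation.
under eq_bigr do rewrite mulr_suml.
rewrite exchange_big; apply: eq_bigr => x _ /=; rewrite mulr_sumr.
by apply: eq_bigr => y _; rewrite mulrA.
Qed.

Lemma evolve_pmf M mu : is_stochastic M -> is_pmf mu -> is_pmf (evolve M mu).
Proof.
move=> Mst [mu0 mu1]; split=> [y|].
  by apply: sumr_ge0 => x _; rewrite mulr_ge0 //; case: (Mst x).
rewrite exchange_big -[RHS]mu1 /=; apply: eq_bigr => x _.
by rewrite -mulr_sumr (proj2 (Mst x)) mulr1.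
Qed.

End MeanVariance.

(** * Contracting drift *)

Section Drift.
Context {K : realType} {S : finType}.
Context (M : S -> S -> K) (Phi : S -> K) (gamma rho R b : K).
Hypothesis Mst : is_stochastic M.
Hypothesis gamma_gt0 : 0 < gamma.
Hypothesis gamma_lt : gamma < 2^-1.
Hypothesis rho_gt0 : 0 < rho.
Hypothesis drift : forall s : S,
  (1 - gamma) * Phi s - rho <= step_expectation M Phi s
    <= (1 - gamma) * Phi s + rho.
Hypothesis jump : forall s : S,
  step_expectation M (fun y => (Phi y - Phi s) ^+ 2) s <= R.
Hypothesis Phi_le : forall s, Phi s <= b.
Hypothesis b_ge0 : 0 <= b.
Implicit Types mu : S -> K.

Lemma mean_drift mu : is_pmf mu ->
  (1 - gamma) * mean mu Phi - rho <= mean (evolve M mu) Phi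
    <= (1 - gamma) * mean mu Phi + rho.
Proof.
move=> mup; rewrite mean_evolve.
have affE c : mean mu (fun s => (1 - gamma) * Phi s + 0 * Phi s + c)
    = (1 - gamma) * mean mu Phi + c by rewrite mean_affine //; ring.
rewrite -!affE; apply/andP; split; apply: le_mean => // s;
  by have /andP[] := drift s; lra.
Qed.

Lemma mean_stationary_drift mu : stationary M mu ->
  - (rho / gamma) <= mean mu Phi <= rho / gamma.
Proof.
move=> [mup muM]; have := mean_drift mup.
have -> : mean (evolve M mu) Phi = mean mu Phi.
  by apply: eq_bigr => s _; rewrite -muM.
by rewrite -mulNr ler_pdivlMr // ler_pdivrMr // => /andP[]; lra.
Qed.

(** Since [b] bounds [Phi] only from above, the drift error is controlled
    through [`|Phi| <= 2 * b - Phi], whose right side is affine in [Phi]. *)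
Lemma step_sqr_le s : step_expectation M (fun y => Phi y ^+ 2) s
  <= (1 - 2 * gamma) * Phi s ^+ 2 + (- (2 * rho)) * Phi s + (R + 4 * rho * b).
Proof.
have := jump s; rewrite /step_expectation -!/(mean _ _).
rewrite mean_sqr_shift //.
have /andP[] := drift s; rewrite /step_expectation -!/(mean _ _).
have := Phi_le s.
set p := Phi s; set e := mean (M s) Phi => pb lo hi jmp.
have [p0|p0] := leP 0 p.
  have : p * e <= p * ((1 - gamma) * p + rho) by rewrite ler_wpM2l.
  have : rho * p <= rho * b by rewrite ler_wpM2l // ltW.
  by rewrite expr2; lra.
have : p * e <= p * ((1 - gamma) * p - rho) by rewrite ler_wnM2l // ltW.
have : 0 <= rho * b by rewrite mulr_ge0 // ltW.
by rewrite expr2; lra.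
Qed.

(** The linear term of [step_sqr_le] and the error in squaring the new mean add
    up to [2 * rho * (2 * b - m + `|m|)], where [m] is the old mean. This is
    [4 * rho * b] for [m] nonnegative, and a mean as low as [- b / 2] costs at
    most [2 * rho * b] more: hence the constant 6. *)
Lemma variance_contract mu : is_pmf mu -> - (b / 2) <= mean mu Phi ->
  variance (evolve M mu) Phi
    <= (1 - 2 * gamma) * variance mu Phi + (R + 6 * rho * b).
Proof.
have [g0 g2] := (gamma_gt0, gamma_lt).
move=> mup mb; have mup' := evolve_pmf Mst mup.
rewrite !varianceE // mean_evolve.
have := le_mean mup step_sqr_le.
rewrite (@mean_affine _ _ _ (fun s => Phi s ^+ 2)) //.
have /andP[] := mean_drift mup; move: mb (mean_le_cst mup Phi_le).
set m := mean mu Phi; set m' := mean (evolve M mu) Phi => mb mle lo hi sq.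
have g1 : 0 < 1 - gamma by lra.
(* The new mean is squared from below by its tangent at [(1 - gamma) * m]:
   [m' ^+ 2 >= 2 * c * m' - c ^+ 2] with [c := (1 - gamma) * m]. *)
have := sqr_ge0 (m' - (1 - gamma) * m).
have gm0 := sqr_ge0 (gamma * m).
have rb : 0 <= rho * b by rewrite mulr_ge0 // ltW.
have [m0|m0] := leP 0 m.
  have : (1 - gamma) * m * ((1 - gamma) * m - rho) <= (1 - gamma) * m * m'.
    by rewrite ler_wpM2l // mulr_ge0 // ltW.
  have : 0 <= gamma * (rho * m) by rewrite !mulr_ge0 // ltW.
  by rewrite !expr2 in gm0 *; lra.
have : (1 - gamma) * m * ((1 - gamma) * m + rho) <= (1 - gamma) * m * m'.
  by rewrite ler_wnM2l // pmulr_rle0 // ltW.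
have : rho * (- m) <= rho * (b / 2) by rewrite (ler_wpM2l (ltW rho_gt0)) //; lra.
have : gamma * (rho * m) <= 0.
  by rewrite !pmulr_rle0 // ltW.
by rewrite !expr2 in gm0 *; lra.
Qed.

(** The fixed point of the affine contraction in [variance_contract]. *)
Let V : K := (R + 6 * rho * b) / (2 * gamma).

Lemma variance_invariant mu : is_pmf mu -> - (b / 2) <= mean mu Phi ->
  variance mu Phi <= V -> variance (evolve M mu) Phi <= V.
Proof.
have [g0 g2] := (gamma_gt0, gamma_lt).
move=> mup mb vmu; apply: le_trans (variance_contract mup mb) _.
have VE : R + 6 * rho * b = 2 * gamma * V.
  by rewrite /V; field; rewrite gt_eqF.
have := ler_wpM2l (_ : 0 <= 1 - 2 * gamma) vmu.
by rewrite VE => /(_ ltac:(lra)); lra.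
Qed.

(** The law [mu] is its own image under [M], so [variance_contract] bounds its
    variance by the fixed point [V]. *)
Lemma variance_stationary_le mu : stationary M mu -> 2 * rho / gamma <= b ->
  variance mu Phi <= V.
Proof.
have [g0 r0] := (gamma_gt0, b_ge0).
move=> muM rb; have /andP[lo _] := mean_stationary_drift muM.
have [mup muE] := muM.
have := @variance_contract mu mup; rewrite ler_pdivlMr ?mulr_gt0 //.
have -> : evolve M mu = mu by apply/funext => y; rewrite -[RHS]muE.
by move=> /(_ ltac:(lra)); lra.
Qed.

(** The hypothesis [2 * rho / gamma <= b] keeps every mean above [- b / 2], so
    that [variance_invariant] applies at all times. *)
Lemma iter_evolve_drift mu n : is_pmf mu -> mean mu Phi = b ->
  variance mu Phi = 0 -> 2 * rho / gamma <= b ->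
  let mun := iter n (evolve M) mu in
  [/\ is_pmf mun, (1 - gamma) ^+ n * b - rho / gamma <= mean mun Phi
    & variance mun Phi <= V].
Proof.
have [[g0 g2] b0] := (gamma_gt0, gamma_lt, b_ge0).
move=> mup mub mu0 rb /=.
have R0 : 0 <= R.
  have [s _|S0] := pickP (fun _ : S => true).
    by apply: le_trans (jump s); apply: (mean_ge0 (Mst s)) => y; exact: sqr_ge0.
  case: mup => _; rewrite big1 => [/eqP|s _]; first by rewrite eq_sym oner_eq0.
  by have := S0 s.
have rg0 : 0 < rho / gamma by rewrite divr_gt0.
elim: n => [|n [munp lo vn]] /=.
  rewrite expr0 mul1r mub mu0; split=> //; first by lra.
  by rewrite divr_ge0 ?addr_ge0 ?mulr_ge0 // ltW.
split; first exact: evolve_pmf.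
  have /andP[+ _] := mean_drift munp; apply: le_trans.
  have := ler_wpM2l (_ : 0 <= 1 - gamma) lo => /(_ ltac:(lra)).
  have : gamma * (rho / gamma) = rho by rewrite mulrC divfK // gt_eqF.
  by rewrite exprS; lra.
apply: variance_invariant => //; apply: le_trans lo.
have : 0 <= (1 - gamma) ^+ n * b by rewrite mulr_ge0 // exprn_ge0 //; lra.
by lra.
Qed.

End Drift.

(** * The laws of a Markov chain *)

Section Law.
Context {K : realType} {S : finType} {d : measure_display}
  {Omega : measurableType d} (P : probability Omega K).

Lemma measure_finType_partition (F : finType) (Y : Omega -> F) (B : set Omega) :
  (forall z, measurable (Y @^-1` [set z])) -> measurable B ->
  fine (P B) = \sum_(z : F) fine (P (B `&` Y @^-1` [set z])).
Proof.
move=> mY mB.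
have mBY z : measurable (B `&` Y @^-1` [set z]) by apply: measurableI.
have BE : B = \bigcup_(z in [set: F]) (B `&` Y @^-1` [set z]).
  by apply/seteqP; split=> [w Bw|w [z _ []]//]; exists (Y w).
rewrite [in LHS]BE measure_fin_bigcup //; first last.
- exact: trivIset_preimage1_in.
- exact: finite_finset.
have -> : [set: F] = [set` index_enum F].
  by apply/seteqP; split=> // z _ /=; rewrite mem_index_enum.
rewrite -fsbig_seq ?index_enum_uniq //.
under eq_bigr do rewrite -(fineK (fin_num_measure P _ (mBY _))).
by rewrite sumEFin.
Qed.

Context (X : nat -> Omega -> S).

Lemma law_pmf t : (forall s, measurable (X t @^-1` [set s])) ->
  is_pmf (law P X t).
Proof.
move=> mX; split=> [s|]; first by rewrite /law fine_ge0.
have := measure_finType_partition mX measurableT.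
rewrite probability_setT /= => ->.
by apply: eq_bigr => s _; rewrite setTI.
Qed.

Lemma law_point t s0 : (forall s, measurable (X t @^-1` [set s])) ->
  P (X t @^-1` [set s0]) = 1%E -> law P X t = fun s => (s == s0)%:R.
Proof.
move=> mX Ps0; have [l0 l1] := law_pmf mX.
have ls0 : law P X t s0 = 1 by rewrite /law Ps0.
apply/funext => s; have [->//|ss0] := eqVneq s s0.
move: l1; rewrite (bigD1 s0) //= ls0 -[RHS]addr0 => /addrI /eqP.
rewrite psumr_eq0 // => /allP/(_ s (mem_index_enum _)).
by rewrite ss0 => /eqP.
Qed.

(** The Markov property conditions on whole histories, so both sides are split
    over the finitely many trajectories [h] up to time [t]. Histories of
    probability zero contribute nothing to either side. *)
Lemma law_evolve (M : S -> S -> K) t : markov_chain P X M ->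
  law P X t.+1 = evolve M (law P X t).
Proof.
move=> [mX Mst markov]; apply/funext => y.
pose Y w := [ffun i : 'I_t.+1 => X i w].
pose ext (h : {ffun 'I_t.+1 -> S}) (n : nat) := h (inord n).
have YE h : Y @^-1` [set h] = history X (ext h) t.
  apply/seteqP; split=> w /=.
    by move=> <- i it; rewrite /ext ffunE inordK.
  move=> hw; apply/ffunP => i; rewrite ffunE hw -1?ltnS // /ext inord_val.
  by [].
have mH h : measurable (history X (ext h) t).
  have -> : history X (ext h) t
      = \bigcap_(i in [set i | (i <= t)%N]) (X i @^-1` [set ext h i]) by [].
  by apply: bigcap_measurable => //; exists 0%N.
have mY h : measurable (Y @^-1` [set h]) by rewrite YE.
have stepE h : fine (P (X t.+1 @^-1` [set y] `&` history X (ext h) t))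
    = fine (P (history X (ext h) t)) * M (ext h t) y.
  have [P0|Pn0] := eqVneq (P (history X (ext h) t)) 0%E.
    rewrite P0 mul0r (_ : P _ = 0%E) //; apply/eqP.
    by rewrite eq_le measure_ge0 andbT -P0 le_measure ?inE //; apply: measurableI.
  have Pgt0 : (0 < P (history X (ext h) t))%E by rewrite lt0e Pn0 measure_ge0.
  rewrite -(markov _ _ _ Pgt0) /cond_prob mulrC divfK // gt_eqF //.
  by rewrite fine_gt0 // Pgt0 ltey_eq fin_num_measure.
have lastE x h : fine (P (X t @^-1` [set x] `&` history X (ext h) t))
    = (ext h t == x)%:R * fine (P (history X (ext h) t)).
  have [hx|hx] := eqVneq (ext h t) x.
    rewrite mul1r; congr (fine (P _)); apply/setIidr => w /= hw.
    by rewrite hw.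
  rewrite mul0r (_ : _ `&` _ = set0) ?measure0 //.
  by apply/seteqP; split=> // w /= [xw hw]; move: hx; rewrite -xw hw ?eqxx.
rewrite /evolve [LHS](measure_finType_partition mY) //.
under [RHS]eq_bigr do rewrite /law (measure_finType_partition mY) // mulr_suml.
rewrite exchange_big; apply: eq_bigr => h _ /=.
rewrite YE stepE (bigD1 (ext h t)) //= lastE eqxx mul1r big1 ?addr0 //.
by move=> x xh; rewrite lastE eq_sym (negbTE xh) !mul0r.
Qed.

Lemma law_iter (M : S -> S -> K) t : markov_chain P X M ->
  law P X t = iter t (evolve M) (law P X 0).
Proof. by move=> mc; elim: t => //= t <-; exact: law_evolve. Qed.

End Law.

(** * The lower bound on the distance to stationarity *)

Lemma le_geometric_of_ln (K : realType) (a b D : K) (t : nat) :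
  0 < a < 1 -> 0 < b -> 0 < D ->
  t%:R <= (ln b - ln D) / - ln a -> D <= a ^+ t * b.
Proof.
move=> /andP[a0 a1] b0 D0.
have lna : ln a < 0 by rewrite ln_lt0 // a0.
rewrite ler_pdivlMr ?oppr_gt0 // => le.
have at0 : 0 < a ^+ t by rewrite exprn_gt0.
rewrite -ler_ln ?posrE ?mulr_gt0 // lnM ?posrE // lnXn // -mulr_natl.
by lra.
Qed.

Theorem lemma3p2 (K : realType) (S : finType) (d : measure_display)
  (Omega : measurableType d) (P : probability Omega K)
  (X : nat -> Omega -> S) (M : S -> S -> K) (pi : S -> K)
  (hX : markov_chain P X M)
  (hirr : irreducible_chain M) (haper : aperiodic_chain M)
  (hpi : stationary M pi)
  (Phi : S -> K) (gamma rho : K)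
  (hgamma : 0 < gamma < 2^-1) (hrho : 0 < rho)
  (hdrift : forall s : S,
    (1 - gamma) * Phi s - rho <= step_expectation M Phi s
      <= (1 - gamma) * Phi s + rho)
  (s0 : S) (R : K)
  (hR : max_over s0
          (fun s => step_expectation M (fun y => (Phi y - Phi s) ^+ 2) s) <= R)
  (hatPhi : K) (hhatPhi : hatPhi = max_over s0 Phi) (hhatPhi0 : 0 < hatPhi)
  (hs0 : Phi s0 = hatPhi)
  (hstart : P (X 0%N @^-1` [set s0]) = 1%E)
  (epsilon : K) (hepsilon : 0 < epsilon)
  (T : K)
  (hT : T = (ln hatPhi
             - ln (2 * rho / gamma
                   + Num.sqrt (4 * (R + 6 * rho * hatPhi) / (gamma * epsilon))))
            / (- ln (1 - gamma)))
  (t : nat) (ht : t%:R <= T) :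
  1 - epsilon <= tv_norm (law P X t) pi.
Proof.
have [mX Mst _] := hX; have /andP[g0 g2] := hgamma.
have jump s : step_expectation M (fun y => (Phi y - Phi s) ^+ 2) s <= R.
  apply: le_trans hR.
  exact: (le_bigmax _
    (fun s => step_expectation M (fun y => (Phi y - Phi s) ^+ 2) s)).
have Phi_le s : Phi s <= hatPhi by rewrite hhatPhi; exact: le_bigmax.
have R0 : 0 <= R.
  by apply: le_trans (jump s0); apply: (mean_ge0 (Mst s0)) => y; exact: sqr_ge0.
have Q0 : 0 < R + 6 * rho * hatPhi by rewrite ltr_wpDl // !mulr_gt0.
set sq := Num.sqrt _ in hT.
have arg0 : 0 < 4 * (R + 6 * rho * hatPhi) / (gamma * epsilon).
  by rewrite divr_gt0 ?mulr_gt0.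
have sq0 : 0 < sq by rewrite sqrtr_gt0.
have sq2 : sq ^+ 2 = 4 * (R + 6 * rho * hatPhi) / (gamma * epsilon).
  by rewrite sqr_sqrtr // ltW.
have rg0 : 0 < rho / gamma by rewrite divr_gt0.
have big : 2 * rho / gamma + sq <= (1 - gamma) ^+ t * hatPhi.
  by apply: le_geometric_of_ln; rewrite -?hT //; lra.
have rb : 2 * rho / gamma <= hatPhi.
  have : (1 - gamma) ^+ t * hatPhi <= hatPhi.
    by rewrite ler_piMl ?(ltW hhatPhi0) // exprn_ile1 //; lra.
  by lra.
have law0 := law_point (mX 0%N) hstart.
have mean0 f : mean (law P X 0) f = f s0.
  rewrite law0 /mean (bigD1 s0) //= eqxx mul1r big1 ?addr0 // => s /negbTE ->.
  by rewrite mul0r.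
have [mup lo vt] := iter_evolve_drift Mst g0 g2 hrho hdrift jump Phi_le
  (ltW hhatPhi0) t (law_pmf P (mX 0%N)) (etrans (mean0 _) hs0)
  (ltac:(by rewrite /variance !mean0 subrr expr0n)) rb.
rewrite -(law_iter t hX) in mup lo vt.
have /andP[_ pihi] := mean_stationary_drift g0 hdrift hpi.
have vpi := variance_stationary_le Mst g0 g2 hrho hdrift jump Phi_le
  (ltW hhatPhi0) hpi rb.
have -> : epsilon
    = 2 * ((R + 6 * rho * hatPhi) / (2 * gamma)) / (sq / 2) ^+ 2.
  rewrite expr_div_n sq2; field.
  by rewrite !gt_eqF.
apply: (tv_norm_ge_of_means (f := Phi)) => //; first exact: (proj1 hpi).
  by rewrite divr_gt0.
by lra.
Qed.
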